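(* Let $n\geq 3$ be an odd integer. Then the minimum coprime number of the wheel graph $W_n$ is $\mathfrak{pr}(W_n)=n+2$.
   Context: The wheel graph $W_n$ consists of a cycle of length $n$ together with a central vertex adjacent to every vertex of the cycle (so it has $n+1$ vertices). All graphs are finite and simple. A coprime labeling of a graph $G$ of order $N$ is an assignment of distinct labels from $\{1,\ldots,m\}$, for some integer $m\ge N$, to the vertices of $G$ such that adjacent vertices receive relatively prime labels. The minimum coprime number $\mathfrak{pr}(G)$ is the minimum value $m$ for which such a labeling exists. *)

(* Defs.v *)
From mathcomp Require Import all_boot.

Set Implicit Arguments.
Unset Strict Implicit.
Unset Printing Implicit Defensive.

Record sgraph := SGraph {
  vertex :> finType;
  edge : rel vertex;
  edge_sym : symmetric edge;
  edge_irrefl : irreflexive edge }.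

(* Labels live in 'I_m.+1 = {0, ..., m}; the positivity condition restricts
   them to {1, ..., m}. *)
Definition coprime_labeling (G : sgraph) (m : nat)
    (f : {ffun G -> 'I_m.+1}) : bool :=
  [&& injectiveb f,
      [forall v, 0 < f v]
    & [forall u, forall v, edge u v ==> coprime (f u) (f v)]].

Definition coprime_labelable (G : sgraph) (m : nat) : bool :=
  (#|G| <= m) && [exists f : {ffun G -> 'I_m.+1}, coprime_labeling f].

Fixpoint prime_seq (k : nat) : nat :=
  if k is k'.+1 then s2val (prime_above (prime_seq k')) else 2.

Lemma prime_seq_prime k : prime (prime_seq k).
Proof. by case: k => [|k] //=; case: prime_above. Qed.

Lemma prime_seq_ltS k : prime_seq k < prime_seq k.+1.
Proof. by rewrite /=; case: prime_above. Qed.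

Lemma prime_seq_mono : {mono prime_seq : i j / i <= j}.
Proof.
apply: leq_mono; apply: homo_ltn; first exact: ltn_trans.
exact: prime_seq_ltS.
Qed.

Lemma prime_seq_inj : injective prime_seq.
Proof.
exact: (incn_inj prime_seq_mono).
Qed.

Lemma coprime_labelable_ex (G : sgraph) : exists m, coprime_labelable G m.
Proof.
exists (maxn #|G| (prime_seq #|G|)); rewrite /coprime_labelable leq_maxl /=.
have lt_m (v : G) :
    prime_seq (enum_rank v) < (maxn #|G| (prime_seq #|G|)).+1.
  rewrite ltnS leq_max prime_seq_mono orbC.
  by rewrite (ltnW (ltn_ord _)).
apply/existsP; exists [ffun v => Ordinal (lt_m v)]; apply/and3P; split.
- apply/injectiveP => u v; rewrite !ffunE => -[] /prime_seq_inj eq_uv.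
  exact/enum_rank_inj/val_inj.
- by apply/forallP => v; rewrite ffunE /= prime_gt0 ?prime_seq_prime.
apply/forallP => u; apply/forallP => v; apply/implyP => uv; rewrite !ffunE /=.
rewrite prime_coprime ?prime_seq_prime // dvdn_prime2 ?prime_seq_prime //.
rewrite (inj_eq prime_seq_inj); apply: contraTneq uv => /val_inj/enum_rank_inj->.
by rewrite edge_irrefl.
Qed.

Definition min_coprime_number (G : sgraph) : nat :=
  ex_minn (coprime_labelable_ex G).

(* [None] is the hub and [Some i] the i-th rim vertex; [ordS] is the cyclic
   successor on 'I_n. The condition i != j only matters for n = 1, where it
   removes the loop, so that the graph is simple for every n. *)
Definition wheel_edge (n : nat) : rel (option 'I_n) := fun u v =>
  match u, v with
  | None, None => false
  | None, Some _ | Some _, None => true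
  | Some i, Some j => (i != j) && ((j == ordS i) || (i == ordS j))
  end.

Lemma wheel_edge_sym n : symmetric (@wheel_edge n).
Proof. by move=> [i|] [j|] //=; rewrite eq_sym orbC. Qed.

Lemma wheel_edge_irrefl n : irreflexive (@wheel_edge n).
Proof. by move=> [i|] //=; rewrite eqxx. Qed.

Definition wheel (n : nat) : sgraph :=
  SGraph (@wheel_edge_sym n) (@wheel_edge_irrefl n).

(* Main.v *)
Require Import Defs.
From mathcomp Require Import all_boot.
From mathcomp Require Import zify.

(** An odd wheel needs more odd labels than {1, ..., n + 1} has to offer.  Of two
    coprime labels at least one is odd, so the vertices with odd labels form a
    vertex cover of the wheel.  Covering the rim, an odd cycle, takes at least
    (n + 1) / 2 rim vertices
    ([odd_cycle_cover]), and the hub comes on top of that; if the hub is left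
    out, all n rim vertices are needed.  Either way the cover has more than
    (n + 1) / 2 vertices, which is the number of odd integers up to n + 1
    ([sum_odd_inj]).  Hence the largest label is at least n + 2.

    Conversely, label the hub 1 and run through 2, 3, ..., n, n + 2 around the
    rim.  Consecutive integers are coprime, and the two exceptional edges join
    the odd numbers n and n + 2, which differ by 2, and n + 2 and 2. *)

Lemma sum_odd_ord m : \sum_(i < m) odd i = m./2.
Proof. by elim: m => [|m IHm]; rewrite ?big_ord0 // big_ord_recr /= IHm; lia. Qed.

Lemma sum_option (T : finType) (F : option T -> nat) :
  \sum_v F v = F None + \sum_i F (Some i).
Proof.
rewrite (bigD1 None) //= (reindex_omap Some id) => [|[]//].
by congr (_ + _); apply: eq_bigl => i; rewrite eqxx.
Qed.

Lemma coprime_odd a b : coprime a b -> odd a || odd b.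
Proof.
apply: contraLR; rewrite negb_or -!dvdn2 => /andP[a2 b2].
by apply/negP => /eqP ab1; have := dvdn_gcd 2 a b; rewrite ab1 a2 b2.
Qed.

(** The value 0 in 'I_m.+1 is even, so it does not disturb the count of
    the odd labels available. *)
Lemma sum_odd_inj (T : finType) m (f : T -> 'I_m.+1) :
  injective f -> \sum_(v : T) odd (f v) <= m.+1./2.
Proof.
move=> f_inj; rewrite -sum_odd_ord.
rewrite -(big_imset (fun i : 'I_m.+1 => odd i : nat)) /=; last by move=> *; apply: f_inj.
by rewrite [leqRHS](bigID (mem [set f v | v in T])) /= leq_addr.
Qed.

(** Each of the n edges of the cycle has an end in p, and each vertex lies on
    two edges, so twice the size of p is at least n; parity gives the
    rounding up. *)
Lemma odd_cycle_cover n (p : pred 'I_n) :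
  odd n -> (forall i, p i || p (ordS i)) -> n.+1 <= (\sum_i p i).*2.
Proof.
move=> n_odd cover_p.
suff: n <= (\sum_i p i).*2 by lia.
rewrite -addnn {2}(reindex_inj (@ordS_inj n)) -big_split /=.
rewrite -{1}[n]card_ord -sum1_card leq_sum // => i _.
by case: (p i) (cover_p i) => //= ->.
Qed.

Lemma wheel_rim_edge n (i : 'I_n) :
  1 < n -> @edge (wheel n) (Some i) (Some (ordS i)).
Proof.
move=> n_gt1 /=; rewrite eqxx andbT -val_eqE /=.
have := ltn_ord i; rewrite leq_eqVlt => /orP[/eqP iS | lt_iS].
  by rewrite iS modnn; lia.
by rewrite modn_small // neq_ltn leqnn.
Qed.

Lemma wheel_label_ge n m : 3 <= n -> odd n ->
  coprime_labelable (wheel n) m -> n + 2 <= m.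
Proof.
move=> n_ge3 n_odd /andP[_ /existsP[f /and3P[/injectiveP f_inj _ /forallP f_cop]]].
have {}f_cop u v : @edge (wheel n) u v -> odd (f u) || odd (f v).
  by move=> uv; apply: coprime_odd; move: (f_cop u) => /forallP/(_ v)/implyP; apply.
pose p (i : 'I_n) := odd (f (Some i)).
have : odd (f None) + \sum_i p i <= m.+1./2.
  by have := sum_odd_inj _ _ _ f_inj; rewrite sum_option.
have cover_p i : p i || p (ordS i) := f_cop _ _ (wheel_rim_edge _ i (ltnW n_ge3)).
have := odd_cycle_cover _ p n_odd cover_p.
case: (boolP (odd (f None))) => [_|hub_even]; first by lia.
(* With an even hub every rim label is odd, and n > (n + 1) / 2. *)
rewrite (eq_bigr (fun=> 1)) ?sum1_card ?card_ord => [|i _]; first by lia.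
by rewrite /p; have := f_cop None (Some i) isT; rewrite (negPf hub_even) => /= ->.
Qed.

(** The summand (i.+1 == n) makes the last rim vertex skip n + 1.  Skipping an
    even number is safe because the odd numbers around it are coprime; without a skip
    the labels 2, ..., n + 1 would put two even numbers, n + 1 and 2, next to each
    other when the cycle closes. *)
Definition wheel_label n (v : option 'I_n) : nat :=
  if v is Some i then i + 2 + (i.+1 == n) else 1.

Lemma wheel_label_lt n v : wheel_label n v < (n + 2).+1.
Proof. by case: v => [i|] /=; [have := ltn_ord i|]; lia. Qed.

Lemma wheel_label_inj n : injective (wheel_label n).
Proof.
move=> [i|] [j|] //= eq_ij; try lia.
by congr Some; apply/val_inj => /=; have := ltn_ord i; have := ltn_ord j; lia.
Qed.

Lemma coprime_add2 a : odd a -> coprime a (a + 2).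
Proof. by rewrite /coprime gcdnDl -/(coprime a 2) coprimen2. Qed.

Lemma wheel_label_coprime_next n (i : 'I_n) : 3 <= n -> odd n ->
  coprime (wheel_label n (Some i)) (wheel_label n (Some (ordS i))).
Proof.
move=> n_ge3 n_odd /=.
have [last_i | i_lt] := eqVneq i.+1 n.
  rewrite last_i modnn coprime_sym.
  have -> : 0 + 2 + (1 == n) = 2 by lia.
  by rewrite coprime2n; lia.
have iS_lt : i.+1 < n by have := ltn_ord i; lia.
rewrite modn_small // addn0.
have [pen_i | _] := eqVneq i.+2 n.
  have -> : i.+1 + 2 + true = (i + 2) + 2 by lia.
  by apply: coprime_add2; lia.
by rewrite addn0 addSn coprimenS.
Qed.

Lemma wheel_labelable n : 3 <= n -> odd n -> coprime_labelable (wheel n) (n + 2).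
Proof.
move=> n_ge3 n_odd; apply/andP; split; first by rewrite card_option card_ord; lia.
apply/existsP; exists [ffun v => Ordinal (wheel_label_lt n v)].
apply/and3P; split.
- by apply/injectiveP => u v; rewrite !ffunE => -[] /wheel_label_inj.
- by apply/forallP => -[i|]; rewrite ffunE //= addn2.
apply/forallP => u; apply/forallP => v; apply/implyP; rewrite !ffunE.
case: u v => [i|] [j|] //; last 2 first.
- by rewrite coprimen1.
- by rewrite coprime1n.
case/andP => _ /orP[] /eqP->; first exact: wheel_label_coprime_next.
by rewrite coprime_sym; apply: wheel_label_coprime_next.
Qed.

Theorem proposition2 (n : nat) (n_ge3 : 3 <= n) (n_odd : odd n) :
  min_coprime_number (wheel n) = n + 2.
Proof.
rewrite /min_coprime_number; case: ex_minnP => m m_ok m_min.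
apply/eqP; rewrite eqn_leq m_min ?wheel_labelable //=.
exact: wheel_label_ge.
Qed.
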